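(* Let $n$ be a positive integer and let $\overline{m} = (m_1, \ldots, m_n)$ be an $n$-tuple of positive integers. For $I \subseteq [n]$ put $m_I = \sum_{i \in I} m_i$ (so $m_\emptyset = 0$), and put $h = \left\lfloor \frac{n + \sum_{i=1}^{n} m_i}{2} \right\rfloor$. Then the size $s(\overline{m})$ of the largest antichains in the product poset $\prod_{i=1}^{n} [m_i]$ is $$s(\overline{m}) = \sum_{I \subseteq [n] \,:\, m_I \leq h-n} (-1)^{|I|} \binom{h - m_I - 1}{n-1}.$$
   Context: For a positive integer $a$, $[a] = \{1, \ldots, a\}$ with its usual linear order. The set $\prod_{i=1}^{n} [m_i]$ is ordered componentwise: $x \preceq y$ if and only if $x_i \leq y_i$ for all $i \in [n]$. An antichain of a poset is a subset of pairwise incomparable elements, i.e. no two distinct elements are comparable. $s(\overline{m})$ denotes the maximal cardinality of an antichain in $\left(\prod_{i=1}^{n} [m_i], \preceq\right)$. *)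

(* Defs.v *)
From mathcomp Require Import all_boot all_order all_algebra.

Set Implicit Arguments.
Unset Strict Implicit.
Unset Printing Implicit Defensive.

(* [a] = {1, ..., a}, literally (the values start at 1, unlike 'I_a). *)
Definition segment (a : nat) := {k : 'I_a.+1 | (0 < k)%N}.

Definition segment_val (a : nat) (k : segment a) : nat := val (val k).

Definition box (n : nat) (m : 'I_n -> nat) : finType :=
  {dffun forall i : 'I_n, segment (m i)}.

Definition box_le (n : nat) (m : 'I_n -> nat) : rel (box m) :=
  fun x y => [forall i : 'I_n, (segment_val (x i) <= segment_val (y i))%N].

Definition antichain (T : finType) (le : rel T) (A : {set T}) : bool :=
  [forall x in A, forall y in A, (x != y) ==> ~~ le x y && ~~ le y x].

Definition max_antichain (n : nat) (m : 'I_n -> nat) : nat :=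
  \max_(A : {set box m} | antichain (@box_le n m) A) #|A|.

Definition subsum (n : nat) (m : 'I_n -> nat) (I : {set 'I_n}) : nat :=
  \sum_(i in I) m i.

Definition half_height (n : nat) (m : 'I_n -> nat) : nat :=
  (n + \sum_(i < n) m i)./2.

(* Main.v *)
(** By induction on the number of factors, the box is partitioned into saturated
    chains whose end ranks add up to the same number (a chain times a segment
    splits into nested hooks).  Every such chain crosses the middle rank, and
    meets an antichain at most once, so the middle rank is a largest antichain.
    Its size is a coefficient of
    [\prod_i (t + ... + t^m_i) = t^n \prod_i (1 - t^m_i) / (1 - t)^n]. *)
Require Import Defs.
From mathcomp Require Import all_boot all_order all_algebra.
From mathcomp Require Import zify ring.

Import GRing.Theory Num.Theory.
Local Open Scope ring_scope.

(** * Points of a box as lists, with the coordinate sum as rank *)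

Fixpoint points (ms : seq nat) : seq (seq nat) :=
  if ms is m :: ms' then [seq a :: x | a <- iota 1 m, x <- points ms']
  else [:: [::]].

Lemma points_uniq (ms : seq nat) : uniq (points ms).
Proof.
elim: ms => //= m ms IH; apply: allpairs_uniq => //; first exact: iota_uniq.
by move=> [a x] [b y] _ _ [-> ->].
Qed.

Lemma mem_points (ms x : seq nat) :
  (x \in points ms) = all2 (fun m a => 0 < a <= m)%N ms x.
Proof.
elim: ms x => [|m ms IH] [|a x] //=.
  by apply/allpairsP => -[[b y] [_ _]].
rewrite -IH; apply/allpairsP/andP => [[[b y] /= [+ yP [-> ->]]]|[am xP]].
  by rewrite mem_iota add1n ltnS.
by exists (a, x); rewrite mem_iota add1n ltnS.
Qed.

Definition covers (x y : seq nat) : bool :=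
  all2 leq x y && (sumn y == (sumn x).+1).

(** Between componentwise comparable lists, a strict inequality of sums amounts to being
    distinct. *)
Definition strictly_below (x y : seq nat) : bool :=
  all2 leq x y && (sumn x < sumn y)%N.

Lemma strictly_below_trans : transitive strictly_below.
Proof.
move=> y x z /andP[xy sxy] /andP[yz syz]; apply/andP; split; last first.
  exact: ltn_trans sxy syz.
elim: x y z xy yz {sxy syz} => [|a x IH] [|b y] [|c z] //=.
move=> /andP[ab xy] /andP[bc yz]; rewrite (leq_trans ab bc) /=.
exact: IH xy yz.
Qed.

Lemma covers_strictly_below (x y : seq nat) : covers x y -> strictly_below x y.
Proof. by case/andP=> xy /eqP e; rewrite /strictly_below xy e /=. Qed.

(** * Symmetric chain decomposition of a box *)

Definition symmetric_chain (N : nat) (c : seq (seq nat)) : bool :=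
  if c is x :: c' then
    path covers x c' && (sumn x + sumn (last x c') == N)%N
  else false.

(** The first hook follows the row of [a] along the chain, then climbs the column over the chain's
    last element. Dropping that row and that column leaves a smaller product for the next hooks. *)
Fixpoint hooks (c : seq (seq nat)) (s : seq nat) : seq (seq (seq nat)) :=
  if s is a :: s' then
    if c is x :: c' then
      (map (cons a) c ++ map (cons^~ (last x c')) s') :: hooks (belast x c') s'
    else [::]
  else [::].

Lemma flatten_hooks (c : seq (seq nat)) (s : seq nat) :
  perm_eq (flatten (hooks c s)) [seq a :: x | a <- s, x <- c].
Proof.
elim: s c => [|a s IH] [|x c] //=; first by elim: s {IH}.
rewrite perm_cons -catA perm_cat2l.
(* Splitting off the last element of [x :: c] isolates the column already used by the first hook. *)
rewrite -[X in perm_eq _ X]/[seq b :: y | b <- s, y <- x :: c] lastI.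
by rewrite perm_sym allpairs_rconsr perm_sym perm_catC perm_cat2r.
Qed.

Lemma path_cons_covers (a : nat) (x : seq nat) (c : seq (seq nat)) :
  path covers x c -> path covers (a :: x) (map (cons a) c).
Proof.
elim: c x => //= y c IH x /andP[/andP[xy e] /IH ->].
by rewrite /covers /= leqnn xy (eqP e) addnS eqxx.
Qed.

Lemma all2_leqnn (x : seq nat) : all2 leq x x.
Proof. by elim: x => //= a x ->; rewrite leqnn. Qed.

Lemma path_iota_covers (a m : nat) (z : seq nat) :
  path covers (a :: z) (map (cons^~ z) (iota a.+1 m)).
Proof.
elim: m a => //= m IH a; rewrite IH /covers /= leqnSn all2_leqnn addSn eqxx.
by [].
Qed.

Lemma last_iota_cons (a m : nat) (z : seq nat) :
  last (a :: z) (map (cons^~ z) (iota a.+1 m)) = (a + m)%N :: z.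
Proof. by elim: m a => [|m IH] a /=; rewrite ?addn0 // IH addSnnS. Qed.

(** From one hook to the next the bottom rank rises by one, since [a] does, and the top rank falls
    by one, since the chain loses its last element; so the sum of the end ranks is kept. The term
    [(a + m).-1] is the top of the segment. *)
Lemma symmetric_hooks (N a m : nat) (c : seq (seq nat)) :
  symmetric_chain N c ->
  all (symmetric_chain (N + a + (a + m).-1)) (hooks c (iota a m)).
Proof.
elim: m a N c => [|m IH] a N [|x c] //= /andP[xc /eqP <-].
apply/andP; split.
  rewrite cat_path path_cons_covers //= last_cat last_map.
  rewrite path_iota_covers last_iota_cons /=; apply/eqP; lia.
case: (lastP c) xc => [|c' z] xc /=.
  by case: m {IH}.
rewrite last_rcons belast_rcons; move: xc.
rewrite rcons_path => /andP[xc /andP[_ /eqP ez]].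
have /(IH a.+1) : symmetric_chain (sumn x + sumn (last x c')) (x :: c').
  by rewrite /= xc eqxx.
rewrite ez; congr (is_true (all (symmetric_chain _) _)); lia.
Qed.

(** For positive entries, [size ms] and [sumn ms] are the ranks of the least and greatest points;
    each factor [m] adds [1 + m] to the sum of the end ranks. *)
Lemma symmetric_chain_decomposition (ms : seq nat) :
  exists2 D, perm_eq (flatten D) (points ms)
           & all (symmetric_chain (size ms + sumn ms)) D.
Proof.
elim: ms => [|m ms [D pD sD]] /=; first by exists [:: [:: [::]]].
exists (flatten [seq hooks c (iota 1 m) | c <- D]); last first.
  apply/allP => k /flatten_mapP[c /(allP sD) /symmetric_hooks -/(_ 1%N m) h].
  move/(allP h); congr (is_true (symmetric_chain _ _)); lia.
(* Generalizing [points ms] lets the product be split chain by chain. *)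
elim: D {sD} (points ms) pD => [|c D IH] P.
  by rewrite perm_sym => /perm_nilP -> /=; elim: (iota 1 m).
rewrite perm_sym => pP /=; rewrite flatten_cat perm_sym.
rewrite (permPl (perm_allpairs _ (perm_refl _) pP)) perm_allpairs_catr.
rewrite perm_sym perm_cat ?flatten_hooks //; exact: IH.
Qed.

(** * Chains against antichains and the middle rank *)

Lemma path_hits_rank (k : nat) (x : seq nat) (c : seq (seq nat)) :
  path covers x c -> (sumn x <= k <= sumn (last x c))%N ->
  has (fun y => sumn y == k) (x :: c).
Proof.
elim: c x => [|y c IH] x /=; first by move=> _; rewrite -eqn_leq orbF.
case/andP=> /andP[_ /eqP e] yc; case: ltngtP => //= xk h.
by apply: IH => //; rewrite e xk h.
Qed.

Lemma chain_meets_antichain (A : pred (seq nat)) (c : seq (seq nat)) :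
  {in A &, forall x y, ~~ strictly_below x y} ->
  sorted strictly_below c -> (count A c <= 1)%N.
Proof.
move=> anti; elim: c => //= x c IH xc; have {}IH := IH (path_sorted xc).
case Ax: (A x); last by rewrite add0n.
rewrite (_ : count A c = 0%N) //; apply/eqP; rewrite -leqn0 leqNgt -has_count.
apply/hasPn => y yc; apply/negP => Ay.
have /negP[] := anti _ _ Ax Ay.
exact: (allP (order_path_min strictly_below_trans xc)).
Qed.

Lemma middle_rank_max (A : pred (seq nat)) (ms : seq nat) :
  {in A &, forall x y, ~~ strictly_below x y} ->
  (count A (points ms)
     <= count (fun x => sumn x == (size ms + sumn ms)./2) (points ms))%N.
Proof.
move=> anti; have [D pD sD] := symmetric_chain_decomposition ms.
rewrite -!(permP pD) !count_flatten; elim: D sD {pD} => //= c D IH.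
case/andP=> sc /IH; apply: leq_add.
case: c sc => //= x c /andP[xc /eqP e].
(* Each chain holds at most one point of [A] and at least one of middle rank. *)
apply: (@leq_trans 1); last first.
  rewrite -(has_count _ (x :: c)); apply: path_hits_rank => //.
  (* End ranks in increasing order lie on either side of half of their sum. *)
  have : (sumn x <= sumn (last x c))%N.
    elim: c x xc {e} => //= y c IHc x /andP[/andP[_ /eqP e]] /IHc; lia.
  lia.
apply: (@chain_meets_antichain A (x :: c)) => //=.
exact: (sub_path covers_strictly_below) xc.
Qed.

(** * Transfer between the box and lists *)

Definition coords (n : nat) (m : 'I_n -> nat) (x : box m) : seq nat :=
  [seq segment_val (x i) | i <- enum 'I_n].

Arguments coords {n m} x.

Lemma coords_inj (n : nat) (m : 'I_n -> nat) : injective (@coords n m).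
Proof.
move=> x y /eq_in_map e; apply/ffunP => i.
by apply/val_inj/val_inj/e; rewrite mem_enum.
Qed.

Lemma coordsP (n : nat) (m : 'I_n -> nat) (s : seq nat) :
  reflect (exists x : box m, s = coords x)
          (s \in points [seq m i | i <- enum 'I_n]).
Proof.
rewrite mem_points all2E size_map size_enum_ord.
apply: (iffP andP) => [[/eqP es /(all_nthP (0, 0)%N) h]|[x ->]]; last first.
  rewrite size_map size_enum_ord eqxx; split=> //.
  rewrite zip_map all_map; apply/allP => i _ /=.
  by rewrite (valP (x i)) -ltnS ltn_ord.
(* The bounds on each entry of [s] make it a segment element; finite choice collects these into one
   function. *)
have /fin_all_exists[f fP] : forall i : 'I_n,
    exists k : segment (m i), segment_val k = nth 0%N s i.
  move=> i.
  have := h i; rewrite size_zip size_map size_enum_ord -es minnn.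
  move=> /(_ (ltn_ord i)); rewrite nth_zip; last first.
    by rewrite size_map size_enum_ord.
  rewrite (nth_map i) ?size_enum_ord // nth_ord_enum /= => /andP[s0 sm].
  by exists (exist _ (Ordinal (n:=(m i).+1) (m:=nth 0%N s i) sm) s0).
exists [ffun i => f i : segment (m i)].
apply: (@eq_from_nth _ 0%N); first by rewrite -es size_map size_enum_ord.
rewrite -es => i lt_in.
by rewrite (nth_map (Ordinal lt_in)) ?size_enum_ord // ffunE fP nth_enum_ord.
Qed.

Lemma perm_points_coords (n : nat) (m : 'I_n -> nat) :
  perm_eq (points [seq m i | i <- enum 'I_n])
          [seq coords x | x <- enum (box m)].
Proof.
apply: uniq_perm; first exact: points_uniq.
  by rewrite map_inj_uniq ?enum_uniq //; exact: coords_inj.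
move=> s; apply/coordsP/mapP => [[x ->]|[x _ ->]]; exists x => //.
by rewrite mem_enum.
Qed.

Lemma all2_coords (n : nat) (m : 'I_n -> nat) (x y : box m) :
  all2 leq (coords x) (coords y) = box_le x y.
Proof.
rewrite all2E !size_map eqxx zip_map all_map /=.
apply/allP/forallP => h i => [|_]; last exact: h.
by apply: (h i); rewrite mem_enum.
Qed.

Lemma card_coords (n : nat) (m : 'I_n -> nat) (B : pred (seq nat)) :
  #|[set x : box m | B (coords x)]| =
  count B (points [seq m i | i <- enum 'I_n]).
Proof.
rewrite (permP (perm_points_coords n m)) count_map cardsE cardE.
by rewrite size_filter enumT.
Qed.

Lemma max_antichain_middle (n : nat) (m : 'I_n -> nat) :
  max_antichain m =
  count (fun x => sumn x == half_height m) (points [seq m i | i <- enum 'I_n]).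
Proof.
apply/eqP; rewrite eqn_leq; apply/andP; split.
  apply/bigmax_leqP => A /forall_inP anti.
  rewrite (_ : half_height m =
    (size [seq m i | i <- enum 'I_n] + sumn [seq m i | i <- enum 'I_n])./2).
    have -> : #|A| =
        count [in [seq coords x | x in A]] (points [seq m i | i <- enum 'I_n]).
      rewrite -card_coords; apply: eq_card => x.
      by rewrite inE mem_image //; exact: coords_inj.
    apply: middle_rank_max => _ _ /imageP[x xA ->] /imageP[y yA ->].
    apply/negP => /andP[]; rewrite all2_coords => xy lt_xy.
    have ne_xy : x != y by apply: contraTneq lt_xy => ->; rewrite ltnn.
    by have /forall_inP/(_ y yA) := anti x xA; rewrite ne_xy xy.
  by rewrite size_map size_enum_ord sumnE big_map big_enum.
rewrite -card_coords; apply: leq_bigmax_cond.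
apply/forall_inP => x; rewrite inE => /eqP ex.
apply/forall_inP => y; rewrite inE => /eqP ey.
apply/implyP => ne_xy.
(* Under componentwise comparison, equal sums force equal entries, because neither head nor tail can
   grow. *)
have anti (u v : box m) :
    sumn (coords u) = sumn (coords v) -> u != v -> ~~ box_le u v.
  move=> e; apply: contraNN; rewrite -all2_coords => uv.
  apply/eqP/coords_inj; move: e uv.
  elim: (coords u) (coords v) => [|a s IH] [|b t] //= e /andP[ab st].
  have lt_st : (sumn s <= sumn t)%N.
    elim: s t st {e IH} => [|c s IH] [|d t] //= /andP[cd /IH]; exact: leq_add.
  have eab : a = b by lia.
  by rewrite eab (IH t) //; lia.
by rewrite !anti // ?ex ?ey // eq_sym.
Qed.

(** * Generating function of the ranks and its coefficients *)

Lemma points_gen (ms : seq nat) :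
  \sum_(x <- points ms) 'X^(sumn x) =
  \prod_(m <- ms) \sum_(a <- iota 1 m) 'X^a :> {poly int}.
Proof.
elim: ms => [|m ms IH] /=; first by rewrite big_seq1 big_nil.
rewrite big_cons -IH big_allpairs_dep big_distrl; apply: eq_bigr => a _ /=.
by rewrite big_distrr; apply: eq_bigr => x _; rewrite exprD.
Qed.

Lemma coef_points_gen (ms : seq nat) (h : nat) :
  (\sum_(x <- points ms) 'X^(sumn x) : {poly int})`_h =
  (count (fun x => sumn x == h) (points ms))%:Z.
Proof.
elim: (points ms) => [|x P IH] /=; first by rewrite big_nil coef0.
rewrite big_cons coefD IH coefXn eq_sym PoszD; congr (_ + _).
by case: eqP.
Qed.

Lemma segment_gen (m : nat) :
  (\sum_(a <- iota 1 m) 'X^a) * (1 - 'X) = 'X * (1 - 'X^m) :> {poly int}.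
Proof.
elim: m => [|m IH]; first by rewrite big_nil expr0 subrr mulr0 mul0r.
rewrite -{1}[m.+1]addn1 iotaD big_cat big_seq1 mulrDl IH add1n exprS; ring.
Qed.

(* Reads off the power series [p = g / (1 - X)^n.+1] without leaving
   polynomials. *)
Lemma coef_div_exp (n h : nat) (p g : {poly int}) :
  p * (1 - 'X) ^+ n.+1 = g ->
  p`_h = \sum_(j < h.+1) g`_j * ('C(h - j + n, n))%:Z.
Proof.
elim: n p g h => [|n IH] p g h.
  (* Multiplying by [1 - 'X] takes successive differences, so the coefficients of [p] are the
     partial sums of those of [g]. *)
  rewrite expr1 => <-; elim: h => [|h IHh].
    by rewrite big_ord1 bin0 mulr1 mulrBr mulr1 coefB coefMX /= subr0.
  rewrite big_ord_recr /= bin0 mulr1 (eq_bigr (fun j : 'I_h.+1 =>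
    (p * (1 - 'X))`_j * ('C(h - j + 0, 0))%:Z)).
    by rewrite -IHh mulrBr mulr1 coefB coefMX /= addrC subrK.
  by move=> j _; rewrite !bin0.
rewrite exprS mulrA => eg; have {}IH := IH _ _ _ eg.
(* Recovering [p] from the differences one coefficient at a time turns the claim into Pascal's rule,
   term by term. *)
elim: h => [|h IHh].
  have := IH 0%N; rewrite !big_ord1 mulrBr mulr1 coefB coefMX /= subr0 => ->.
  by rewrite subnn !add0n !binn.
have : p`_h.+1 = p`_h + (p * (1 - 'X))`_h.+1.
  by rewrite mulrBr mulr1 coefB coefMX /= addrC subrK.
rewrite IH IHh => ->.
rewrite [X in _ + X]big_ord_recr [RHS]big_ord_recr /= addrA.
rewrite subnn !add0n !binn; congr (_ + _).
rewrite -big_split; apply: eq_bigr => j _ /=.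
have lejh : (j <= h)%N by rewrite -ltnS.
by rewrite -mulrDr -PoszD subSn // [in RHS]addSn binS -addSnnS.
Qed.

(* The truncated subtractions never truncate: n <= h because every m i is
   positive, and m_I + n <= h on the range of summation. *)
Theorem theorem1 (n : nat) (m : 'I_n -> nat)
    (n_gt0 : (0 < n)%N) (m_gt0 : forall i : 'I_n, (0 < m i)%N) :
  (max_antichain m)%:Z =
    \sum_(I : {set 'I_n} | (subsum m I <= half_height m - n)%N)
      (-1) ^+ #|I| * ('C(half_height m - subsum m I - 1, n - 1))%:Z.
Proof.
have le_nh : (n <= half_height m)%N.
  have : (n <= \sum_(i < n) m i)%N.
    by rewrite -{1}(card_ord n) -sum1_card; apply: leq_sum.
  rewrite /half_height; lia.
rewrite max_antichain_middle -coef_points_gen points_gen big_map big_enum /=.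
set h := half_height m; set p := \prod_(i < n) _.
have pE : p * (1 - 'X) ^+ n =
    \sum_(I : {set 'I_n}) (-1) ^+ #|I| *: 'X^(n + subsum m I) :> {poly int}.
  rewrite -[in (1 - 'X) ^+ n](card_ord n) -prodr_const -big_split /=.
  (* The summand [- 'X^(m i)] comes first, so that the set [I] of the expansion collects the factors
     where it is chosen. *)
  rewrite (eq_bigr (fun i => 'X * (- 'X^(m i) + 1))); last first.
    by move=> i _; rewrite segment_gen addrC.
  rewrite big_split /= prodr_const card_ord bigA_distr big_distrr /=.
  apply: eq_bigr => I _; rewrite -big_mkcond prodrN exprD /=.
  by rewrite prodrXr mulrCA -mul_polyC rmorph_sign.
case: n n_gt0 m m_gt0 le_nh @h @p pE => // n _ m _ le_nh h p.
move=> /(coef_div_exp _ h) ->.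
rewrite [RHS]big_mkcond.
under [LHS]eq_bigr do rewrite coef_sum mulr_suml.
(* After the exchange, [I] contributes only at the index [j] equal to [n.+1 + subsum m I], which is
   at most [h] exactly on the range of summation of the theorem. *)
rewrite exchange_big; apply: eq_bigr => I _ /=.
under [LHS]eq_bigr do rewrite coefZ coefXn.
case: leqP => hI; last first.
  rewrite big1 // => j _; rewrite ltn_eqF ?mulr0 ?mul0r //.
  by have := ltn_ord j; lia.
have lt_h : (n.+1 + subsum m I < h.+1)%N by lia.
rewrite (bigD1 (Ordinal lt_h)) //= eqxx mulr1 big1 ?addr0; last first.
  by move=> j /negPf ne; rewrite -val_eqE /= in ne; rewrite ne mulr0 mul0r.
by congr (_ * ('C(_, _))%:Z); lia.
Qed.
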